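(* Let $d$ be a positive integer and let $P_1, P_2\subseteq \mathbb{N}$ be finite nonempty arithmetic progressions with the same common difference $d$, i.e. $P_1=\{a, a+d, a+2d,\ldots,a+kd\}$ and $P_2=\{b,b+d,b+2d,\ldots,b+\ell d\}$ for some $a,b,k,\ell\in\mathbb{N}$. Then $P_1\cup P_2$ is not sum-dominant, i.e. $|(P_1\cup P_2)+(P_1\cup P_2)|\le |(P_1\cup P_2)-(P_1\cup P_2)|$.
   Context: For a finite set $A\subseteq\mathbb{N}$, define the sum set $A+A=\{a_i+a_j : a_i,a_j\in A\}$ and the difference set $A-A=\{a_i-a_j : a_i,a_j\in A\}$. The set $A$ is called sum-dominant if $|A+A|>|A-A|$. *)

(* Defs.v *)
From HB Require Import structures.
From mathcomp Require Import all_boot all_order all_algebra finmap.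

Set Implicit Arguments.
Unset Strict Implicit.
Unset Printing Implicit Defensive.

Local Open Scope fset_scope.

Definition sumset (A : {fset nat}) : {fset nat} :=
  [fset (x + y)%N | x in A, y in A].

(* Differences are taken in int: subtraction on nat is truncated. *)
Definition diffset (A : {fset nat}) : {fset int} :=
  [fset (x%:Z - y%:Z)%R | x in A, y in A].

Definition sum_dominant (A : {fset nat}) : Prop :=
  (#|` diffset A| < #|` sumset A|)%N.

(* {a, a + d, ..., a + k d}: k.+1 terms, hence never empty. *)
Definition arith_prog (a d k : nat) : {fset nat} :=
  [fset (a + i * d)%N | i in iota 0 k.+1].

(* Main.v *)
Require Import Defs.
From HB Require Import structures.
From mathcomp Require Import all_boot all_order all_algebra finmap.
From mathcomp Require Import zify.

(** Write [b = a + D] with [D >= 0] and [M = max k l].  The difference set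
    contains the three progressions [[-M d, M d]], [P2 - P1] and [P1 - P2].
    If they are pairwise disjoint, they already account for
    [2 M + 1 + 2 (k + l + 1) >= 3 (k + l + 1)] differences, the right-hand side
    being the total length of the progressions [P1 + P1], [P1 + P2], [P2 + P2].
    If [[-M d, M d]] meets [P2 - P1], the difference set contains a full
    progression [[-N d, N d]] while all sums lie in [2 a + [0, 2 N d]].
    In the last case [P2 - P1] meets [P1 - P2] but not the multiples of [d]: then
    [2 D] is an odd multiple of [d], the union of [P2 - P1] and [P1 - P2] is a
    progression, and so is a set containing [P1 + P1] and [P2 + P2]; the bound
    follows by comparing lengths. *)

Local Open Scope fset_scope.
Local Open Scope nat_scope.

(** Progressions are sequences so that a concatenation of blocks bounds a cardinal by its size: from
    above by mere inclusion, from below once it is duplicate-free. *)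
Definition nprog (c d n : nat) : seq nat := [seq c + i * d | i <- iota 0 n].

Definition zprog (c : int) (d n : nat) : seq int :=
  [seq (c + (i * d)%:Z)%R | i <- iota 0 n].

Lemma size_nprog c d n : size (nprog c d n) = n.
Proof. by rewrite size_map size_iota. Qed.

Lemma size_zprog c d n : size (zprog c d n) = n.
Proof. by rewrite size_map size_iota. Qed.

Lemma nprogP c d n x :
  reflect (exists2 i, i < n & x = c + i * d) (x \in nprog c d n).
Proof.
apply: (iffP mapP) => [[i]|[i lt_in ->]]; first by rewrite mem_iota => ? ->; exists i.
by exists i; rewrite ?mem_iota.
Qed.

Lemma zprogP c d n x :
  reflect (exists2 i, i < n & x = (c + (i * d)%:Z)%R) (x \in zprog c d n).
Proof.
apply: (iffP mapP) => [[i]|[i lt_in ->]]; first by rewrite mem_iota => ? ->; exists i.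
by exists i; rewrite ?mem_iota.
Qed.

Lemma zprog_uniq c d n : 0 < d -> uniq (zprog c d n).
Proof.
move=> d_gt0; rewrite map_inj_uniq ?iota_uniq // => i j /GRing.addrI [].
by move/eqP; rewrite eqn_pmul2r // => /eqP.
Qed.

Lemma arith_progP a d k x :
  reflect (exists2 i, i <= k & x = a + i * d) (x \in arith_prog a d k).
Proof.
rewrite /arith_prog; apply: (iffP (imfsetP _ _ _ _)) => [[i]|[i le_ik ->]].
  by rewrite (mem_iota 0 k.+1 i) => ? ->; exists i.
by exists i => //; rewrite (mem_iota 0 k.+1 i).
Qed.

Lemma card_fset_le_size (T : choiceType) (A : {fset T}) (s : seq T) :
  {subset A <= s} -> #|` A| <= size s.
Proof. by move=> sub; apply: uniq_leq_size; [apply: fset_uniq | apply: sub]. Qed.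

Lemma size_le_card_fset (T : choiceType) (A : {fset T}) (s : seq T) :
  uniq s -> {subset s <= A} -> size s <= #|` A|.
Proof. by move=> s_uniq sub; apply: uniq_leq_size. Qed.

Lemma mem_diffset (A : {fset nat}) x y :
  x \in A -> y \in A -> (x%:Z - y%:Z)%R \in diffset A.
Proof. by move=> Ax Ay; apply/imfset2P; exists x => //; exists y. Qed.

Lemma zprog_sub_diffset (A : {fset nat}) a b d k l :
  {subset arith_prog a d k <= A} -> {subset arith_prog b d l <= A} ->
  {subset zprog (b%:Z - a%:Z - (k * d)%:Z)%R d (k + l).+1 <= diffset A}.
Proof.
move=> subP subQ x /zprogP[t lt_t ->].
(* Truncated subtraction avoids a split on the witnesses: one of [t - k] and [k - t] is always 0. *)
have -> : (b%:Z - a%:Z - (k * d)%:Z + (t * d)%:Z =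
           (b + (t - k) * d)%N%:Z - (a + (k - t) * d)%N%:Z)%R.
  have [le_tk|lt_kt] := leqP t k.
    by rewrite -{1}(subnKC le_tk) (_ : t - k = 0) //; [lia | apply/eqP].
  by rewrite -{1}(subnKC (ltnW lt_kt)) (_ : k - t = 0); lia.
apply: mem_diffset; [apply: subQ | apply: subP]; apply/arith_progP.
  by exists (t - k) => //; lia.
by exists (k - t) => //; lia.
Qed.

Lemma sumset_progU a b d k l x :
  x \in sumset (arith_prog a d k `|` arith_prog b d l) ->
  [\/ exists2 i, i <= 2 * k & x = 2 * a + i * d,
      exists2 i, i <= k + l & x = a + b + i * d
    | exists2 i, i <= 2 * l & x = 2 * b + i * d].
Proof.
case/imfset2P=> u /=; rewrite in_fsetU => /orP[]/arith_progP[i le_i ->];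
  case=> v /=; rewrite in_fsetU => /orP[]/arith_progP[j le_j ->] ->.
- by constructor 1; exists (i + j); lia.
- by constructor 2; exists (i + j); lia.
- by constructor 2; exists (i + j); lia.
- by constructor 3; exists (i + j); lia.
Qed.

Section ShiftedUnion.

Variables (d a D k l : nat).
Hypothesis d_gt0 : 0 < d.

Let A := arith_prog a d k `|` arith_prog (a + D) d l.
Let M := maxn k l.

Let subP : {subset arith_prog a d k <= A}.
Proof. by move=> x Px; rewrite in_fsetU Px. Qed.

Let subQ : {subset arith_prog (a + D) d l <= A}.
Proof. by move=> x Qx; rewrite in_fsetU Qx orbT. Qed.

Lemma diffset_mid : {subset zprog (- (M * d)%:Z)%R d (2 * M).+1 <= diffset A}.
Proof.
(* The longer of the two progressions minus itself gives the middle block; this identity puts it in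
   the form of [zprog_sub_diffset] with equal starting points. *)
have sub2 n c : (- (n * d)%:Z = c%:Z - c%:Z - (n * d)%:Z)%R.
  by rewrite GRing.subrr GRing.sub0r.
rewrite mul2n -addnn /M; case: (leqP k l) => _.
  by rewrite (sub2 _ (a + D)); apply: zprog_sub_diffset.
by rewrite (sub2 _ a); apply: zprog_sub_diffset.
Qed.

Lemma diffset_right :
  {subset zprog (D%:Z - (k * d)%:Z)%R d (k + l).+1 <= diffset A}.
Proof.
move=> x x_in; apply: (zprog_sub_diffset _ _ _ _ _ _ subP subQ).
by rewrite (_ : (_ - a%:Z = D%:Z)%R) //; lia.
Qed.

Lemma diffset_left :
  {subset zprog (- D%:Z - (l * d)%:Z)%R d (k + l).+1 <= diffset A}.
Proof.
move=> x x_in; apply: (zprog_sub_diffset _ _ _ _ _ _ subQ subP).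
by rewrite (addnC l) (_ : (a%:Z - _ = - D%:Z)%R) //; lia.
Qed.

Lemma card_sumset_le : #|` sumset A| <= 3 * (k + l).+1.
Proof.
pose s := nprog (2 * a) d (2 * k).+1 ++ nprog (a + (a + D)) d (k + l).+1
          ++ nprog (2 * (a + D)) d (2 * l).+1.
have -> : 3 * (k + l).+1 = size s by rewrite !size_cat !size_nprog; lia.
apply: card_fset_le_size => x /sumset_progU; rewrite !mem_cat.
case=> -[i le_i ->]; apply/or3P; [constructor 1|constructor 2|constructor 3];
  by apply/nprogP; exists i.
Qed.

(** An overlap of the middle block with an outer one would give [D = z * d] with [z <= k + M], and
    one between the outer blocks [2 * D = e * d] with [e <= 2 * k]. As [D >= 0], the truncated
    subtractions in the witnesses are exact. *)
Lemma card_diffset_ge_disjoint :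
  (forall z, z <= k + M -> D <> z * d) ->
  (forall e, e <= 2 * k -> 2 * D <> e * d) ->
  3 * (k + l).+1 <= #|` diffset A|.
Proof.
move=> noz noe.
pose s := zprog (- (M * d)%:Z)%R d (2 * M).+1
  ++ zprog (D%:Z - (k * d)%:Z)%R d (k + l).+1
  ++ zprog (- D%:Z - (l * d)%:Z)%R d (k + l).+1.
apply: (@leq_trans (size s)).
  rewrite !size_cat !size_zprog; rewrite /M; lia.
apply: size_le_card_fset; last first.
  move=> x; rewrite !mem_cat => /or3P[]; first exact: diffset_mid.
    exact: diffset_right.
  exact: diffset_left.
rewrite !cat_uniq !zprog_uniq // !andTb andbT; apply/andP; split; apply/hasPn => x.
  rewrite mem_cat => x_in; apply/negP => /zprogP[j lt_j def_x].
  case/orP: x_in => /zprogP[i lt_i def_x'].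
    by apply: (noz (j + k - (M + i))); rewrite ?mulnBl; lia.
  by apply: (noz (i + M - (l + j))); rewrite ?mulnBl; lia.
move=> /zprogP[i lt_i ->]; apply/negP => /zprogP[j lt_j E].
by apply: (noe (i + k - (l + j))); rewrite ?mulnBl; lia.
Qed.

Lemma card_le_aligned z :
  z <= k + M -> D = z * d -> #|` sumset A| <= #|` diffset A|.
Proof.
move=> le_z defD; pose N := maxn k (z + l).
apply: (@leq_trans (2 * N).+1).
  rewrite -(size_nprog (2 * a) d (2 * N).+1).
  apply: card_fset_le_size => x /sumset_progU[] [i le_i ->]; apply/nprogP.
  - by exists i; rewrite /N; lia.
  - by exists (z + i); rewrite ?/N; lia.
  - by exists (2 * z + i); rewrite ?/N; lia.
rewrite -(size_zprog (- (N * d)%:Z)%R d (2 * N).+1).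
apply: size_le_card_fset; first exact: zprog_uniq.
move=> x /zprogP[t lt_t ->].
(* In units of [d] the blocks are [[-z-l, k-z]], [[-M, M]] and [[z-k, z+l]]; [z <= k + M] leaves no
   gap between them. If [N > M] then [N = z + l], so the outer ones reach the ends. *)
have [t_lo|t_hi] := ltnP t (N - M).
  apply: diffset_left; apply/zprogP; exists (t + z + l - N).
    by rewrite /N /M in lt_t t_lo *; lia.
  by rewrite /N /M in lt_t t_lo *; nia.
have [t_mid|t_hi2] := leqP t (N + M).
  apply: diffset_mid; apply/zprogP; exists (t + M - N); first lia.
  by rewrite /N /M in lt_t t_hi t_mid *; nia.
apply: diffset_right; apply/zprogP; exists (t + k - N - z).
  by rewrite /N /M in lt_t t_hi2 le_z *; lia.
by rewrite /N /M in lt_t t_hi2 le_z *; nia.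
Qed.

Lemma card_le_half_aligned e :
  e <= 2 * k -> 2 * D = e * d -> (forall z, D <> z * d) ->
  #|` sumset A| <= #|` diffset A|.
Proof.
(* Relative to [D], in units of [d], [P2 - P1] is [[-k, l]] and [P1 - P2] is [[-(l+e), k-e]]. They
   meet because [e <= 2 * k], so their union is [[-X, Y]]; truncating [k - e] at 0 is harmless since
   [l >= 0]. *)
move=> le_e def2D noz; pose X := maxn k (l + e); pose Y := maxn l (k - e).
apply: (@leq_trans ((maxn (2 * k) (e + 2 * l)).+1 + (k + l).+1)).
  pose s := nprog (2 * a) d (maxn (2 * k) (e + 2 * l)).+1
            ++ nprog (a + (a + D)) d (k + l).+1.
  have <- : size s = (maxn (2 * k) (e + 2 * l)).+1 + (k + l).+1.
    by rewrite size_cat !size_nprog.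
  apply: card_fset_le_size => x /sumset_progU; rewrite mem_cat.
  case=> -[i le_i ->]; apply/orP.
  - by left; apply/nprogP; exists i; lia.
  - by right; apply/nprogP; exists i.
  - by left; apply/nprogP; exists (e + i); rewrite ?mulnDl; lia.
pose s := zprog (- (M * d)%:Z)%R d (2 * M).+1
          ++ zprog (D%:Z - (X * d)%:Z)%R d (X + Y).+1.
apply: (@leq_trans (size s)).
  (* If the maximum is [2 * k], use [M >= k] and [X + Y >= k + l]; otherwise [2 * M >= k + l] and
     [X + Y >= e + 2 * l]. *)
  by rewrite !size_cat !size_zprog /M /X /Y; lia.
apply: size_le_card_fset.
  rewrite cat_uniq !zprog_uniq // !andTb andbT; apply/hasPn => x.
  move=> /zprogP[i lt_i ->]; apply/negP => /zprogP[j lt_j E].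
  by apply: (noz (j + X - (M + i))); rewrite mulnBl; lia.
move=> x; rewrite mem_cat => /orP[]; first exact: diffset_mid.
move=> /zprogP[t lt_t ->].
have [in_right|notin_right] := boolP (X - k <= t <= X + l).
  apply: diffset_right; apply/zprogP; exists (t + k - X).
    by lia.
  by rewrite mulnBl; have := leq_maxl k (l + e); rewrite -/X; nia.
apply: diffset_left; apply/zprogP; exists (t + l + e - X).
  by rewrite /X /Y in lt_t notin_right *; lia.
by rewrite mulnBl; rewrite /X /Y in lt_t notin_right *; nia.
Qed.

Lemma card_sumset_le_diffset : #|` sumset A| <= #|` diffset A|.
Proof.
have [/existsP[z /eqP defD]|/existsPn noz] := boolP [exists z : 'I_(k + M).+1, D == z * d].
  by apply: card_le_aligned defD; rewrite -ltnS.
have {}noz z : z <= k + M -> D <> z * d.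
  by rewrite -ltnS => lt_z; have /eqP := noz (Ordinal lt_z).
have [/existsP[e /eqP def2D]|/existsPn noe] :=
    boolP [exists e : 'I_(2 * k).+1, 2 * D == e * d].
  have le_e : e <= 2 * k by rewrite -ltnS.
  (* The bounded [noz] suffices: [D = z * d] would force [2 * z = e <= 2 * k], hence [z <= k]. *)
  apply: (card_le_half_aligned e) => // z defD.
  have : 2 * z * d == e * d by rewrite -mulnA -defD def2D.
  by rewrite eqn_pmul2r // => /eqP ze; apply: (noz z) => //; lia.
apply: leq_trans card_sumset_le _; apply: card_diffset_ge_disjoint => // e.
by rewrite -ltnS => lt_e; have /eqP := noe (Ordinal lt_e).
Qed.

End ShiftedUnion.

Theorem theorem1 (d a b k l : nat) (hd : (0 < d)%N) :
  ~ sum_dominant (arith_prog a d k `|` arith_prog b d l).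
Proof.
apply/negP; rewrite -leqNgt.
wlog le_ab : a b k l / a <= b.
  move=> H; have [|/ltnW] := leqP a b; first exact: H.
  by rewrite fsetUC; apply: H.
by rewrite -(subnKC le_ab); apply: card_sumset_le_diffset.
Qed.
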